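(* Let $G=(V,E)$ be a perfect graph, let $P=\mathrm{STAB}(G)$ be its stable set polytope, and let $d$ be the dimension of $P$. Then $f_0(P)f_{d-1}(P)\leq d2^{d+1}$, and equality holds if and only if $P$ is affinely isomorphic to the $d$-dimensional cube or the $d$-dimensional cross-polytope.
   Context: For a $d$-dimensional polytope $P$, $f_0(P)$ is its number of vertices and $f_{d-1}(P)$ its number of facets. Convention for $d=0$: a point has no facets, so the product is $0$, and the $0$-dimensional cube and cross-polytope are points. The $d$-dimensional cube is $[-1,1]^d$ and the $d$-dimensional cross-polytope is its polar. Graphs are finite and simple. $\mathrm{STAB}(G)\subseteq\mathbb{R}^V$ is the convex hull of the characteristic vectors of all stable sets of $G$ (including the empty one). *)

(* Defs.v *)
From HB Require Import structures.
From mathcomp Require Import all_boot all_order all_algebra finmap.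
From mathcomp Require Import boolp classical_sets functions cardinality reals.

Set Implicit Arguments.
Unset Strict Implicit.
Unset Printing Implicit Defensive.

Import Order.TTheory GRing.Theory Num.Theory.
Local Open Scope classical_set_scope.
Local Open Scope ring_scope.

Section Graphs.
Variables (T : finType) (e : rel T).

Definition stable (S : {set T}) : bool :=
  [forall x in S, forall y in S, ~~ e x y].

Definition clique (K : {set T}) : bool :=
  [forall x in K, forall y in K, (x != y) ==> e x y].

Definition clique_number : nat := \max_(K : {set T} | clique K) #|K|.

Definition colorable (k : nat) : bool :=
  [exists f : {ffun T -> 'I_k}, forall x, forall y, e x y ==> (f x != f y)].

Definition induced (S : {set T}) : rel {x : T | x \in S} :=
  [rel x y | e (val x) (val y)].

End Graphs.

(* Irreflexivity is needed: a vertex carrying a loop cannot be coloured. *)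
Lemma colorable_card (T : finType) (e : rel T) :
  irreflexive e -> exists k, colorable e k.
Proof.
move=> irr; exists #|T|; apply/existsP; exists [ffun x => enum_rank x].
apply/forallP=> x; apply/forallP=> y; apply/implyP=> exy; rewrite !ffunE.
by apply/eqP=> /enum_rank_inj exy'; rewrite exy' irr in exy.
Qed.

Lemma induced_irreflexive (T : finType) (e : rel T) (S : {set T}) :
  irreflexive e -> irreflexive (induced e (S := S)).
Proof. by move=> irr x; exact: irr. Qed.

Definition chromatic_number (T : finType) (e : rel T) (irr : irreflexive e) :
  nat := ex_minn (colorable_card irr).

Definition perfect (T : finType) (e : rel T) (irr : irreflexive e) : Prop :=
  forall S : {set T},
    chromatic_number (induced_irreflexive (S := S) irr)
    = clique_number (induced e (S := S)).

Section Polytopes.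
Variables (R : realType) (W : vectType R).
Implicit Types (A P F : set W).

Definition convex_hull A : set W :=
  [set x | exists (n : nat) (w : 'I_n -> R) (p : 'I_n -> W),
    [/\ forall i, 0 <= w i, \sum_i w i = 1, forall i, A (p i)
      & x = \sum_i w i *: p i]].

Definition affine_hull A : set W :=
  [set x | exists (n : nat) (w : 'I_n -> R) (p : 'I_n -> W),
    [/\ \sum_i w i = 1, forall i, A (p i) & x = \sum_i w i *: p i]].

(* The dimension of the affine hull. The affine hull of the empty set is not a
   flat, so [affine_dim set0] is the default value 0: hence the nonemptiness
   conditions in [vertices] and [facets]. *)
Definition affine_dim A : nat :=
  xget 0%N [set d | exists (x0 : W) (U : {vspace W}),
    affine_hull A = [set x0 + u | u in [set u | u \in U]] /\ \dim U = d].

Definition face P F : Prop :=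
  exists (c : {scalar W}) (b : R),
    (forall x, P x -> c x <= b) /\ F = P `&` [set x | c x = b].

Definition vertices P : set (set W) :=
  [set F | [/\ face P F, F !=set0 & affine_dim F = 0%N]].

(* Since facets are nonempty, a point has none. *)
Definition facets P : set (set W) :=
  [set F | [/\ face P F, F !=set0 & (affine_dim F).+1 = affine_dim P]].

(* [fset_set] is faithful on finite sets only; a polytope has finitely many
   faces. *)
Definition num_vertices P : nat := #|` fset_set (vertices P) |.
Definition num_facets P : nat := #|` fset_set (facets P) |.

End Polytopes.

Definition affinely_isomorphic (R : realType) (W1 W2 : vectType R)
    (P : set W1) (Q : set W2) : Prop :=
  exists (f : {linear W1 -> W2}) (b : W2), set_bij P Q (fun x => f x + b).

(* [R ^ I]; the regular module [R^o] is what carries the vector space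
   structure over [R]. *)
Notation coords R I := {ffun I -> R^o}.

Definition polar (R : realType) (I : finType) (P : set (coords R I)) :
  set (coords R I) := [set y | forall x, P x -> \sum_i x i * y i <= 1].

Definition cube (R : realType) (d : nat) : set (coords R 'I_d) :=
  [set x | forall i, -1 <= x i <= 1].
Arguments cube : clear implicits.

Definition cross_polytope (R : realType) (d : nat) : set (coords R 'I_d) :=
  polar (cube R d).
Arguments cross_polytope : clear implicits.

Definition char_vector (R : realType) (V : finType) (S : {set V}) :
  coords R V := [ffun v => (v \in S)%:R].

Definition STAB (R : realType) (V : finType) (e : rel V) : set (coords R V) :=
  convex_hull [set x | exists2 S : {set V}, stable e S & x = char_vector R S].
Arguments STAB R {V} e.

(* Main.v *)
From HB Require Import structures.
Require Import Defs.
From mathcomp Require Import boolp classical_sets cardinality.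
From mathcomp Require Import all_boot all_order all_algebra finmap reals lra.

(** Let [n] be the number of vertices of the graph, [s] the number of its stable
    sets and [m] the number of its maximal cliques. The polytope has dimension
    [n] and its vertices are the [s] characteristic vectors. By perfection
    (Lovász, Fulkerson, Chvátal) each facet lies in a hyperplane [x v = 0] or in
    a hyperplane where the sum of [x] over a maximal clique is [1], so there are
    at most [n + m] facets. The bound thus reduces to [s * n <= n * 2 ^ n], which
    is clear, and [s * m <= n * 2 ^ n].

    For the latter, sort the pairs of a stable set [S] and a maximal clique [K]
    by the union [W] of [S] and [K]. Since [S] and [K] share at most one vertex,
    the pairs with union [W] are of two kinds, and there are at most [#|W|] of
    each: [card_meeting_pairs] and [card_disjoint_pairs]. Twice the sum of [#|W|]
    over all [W] is [n * 2 ^ n].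

    For the facets, [weighted_colouring] extends the equality of chromatic number
    and clique number to vertex weights, which gives a clique that meets every
    stable set of maximum weight ([clique_meeting_maximum_stable]). If the form
    defining a facet is taken as the weight, this clique provides the hyperplane
    ([facets_STAB]).

    If equality holds then [s = 2 ^ n], so the graph has no edge and the polytope
    is the unit cube. Conversely the cube and the cross-polytope are centrally
    symmetric; a point reflection preserving the stable set polytope sends [0] to
    a point [y] with all coordinates at least [1], which the inequality of an edge
    forbids. Hence the graph has no edge and the polytope is the unit cube, with
    [2 ^ n] vertices and [2 * n] facets. *)

Set Implicit Arguments.
Unset Strict Implicit.
Unset Printing Implicit Defensive.

Import Order.TTheory GRing.Theory Num.Theory.

(** * Stable sets against maximal cliques *)

Section Counting.
Variables (V : finType) (E : rel V).
Hypotheses (symE : symmetric E) (irrE : irreflexive E).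
Implicit Types (S K W : {set V}) (v : V).

Lemma stable_nadj S x y : stable E S -> x \in S -> y \in S -> E x y = false.
Proof.
by move=> /forall_inP stS /stS /forall_inP xS /xS; apply: negbTE.
Qed.

Lemma clique_adj K x y : clique E K -> x \in K -> y \in K -> x != y -> E x y.
Proof. by move=> /forall_inP clK /clK /forall_inP xK /xK /implyP. Qed.

Lemma stable_clique_eq S K x y : stable E S -> clique E K ->
  x \in S :&: K -> y \in S :&: K -> x = y.
Proof.
move=> stS clK /setIP[xS xK] /setIP[yS yK]; apply: contraTeq isT => neq_xy.
by rewrite -(clique_adj clK xK yK neq_xy) (stable_nadj stS).
Qed.

Lemma card_stable_clique S K : stable E S -> clique E K -> #|S :&: K| <= 1.
Proof.
move=> stS clK; apply/card_le1_eqP => x y xI yI.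
exact: (stable_clique_eq stS clK).
Qed.

Lemma stable0 : stable E set0.
Proof. by apply/forall_inP => x; rewrite inE. Qed.

Lemma stable1 v : stable E [set v].
Proof.
by apply/forall_inP => x /set1P->; apply/forall_inP => y /set1P->; rewrite irrE.
Qed.

Lemma stableS S S' : S \subset S' -> stable E S' -> stable E S.
Proof.
move=> /subsetP sSS' stS'; apply/forall_inP => x xS; apply/forall_inP => y yS.
by rewrite (stable_nadj stS') ?sSS'.
Qed.

Lemma clique0 : clique E set0.
Proof. by apply/forall_inP => x; rewrite inE. Qed.

Lemma clique1 v : clique E [set v].
Proof.
apply/forall_inP => x /set1P->; apply/forall_inP => y /set1P->.
by rewrite eqxx.
Qed.

Lemma cliqueU1 K v : clique E K -> (forall x, x \in K -> E v x) ->
  clique E (v |: K).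
Proof.
move=> clK adj; apply/forall_inP => x /setU1P[->|xK];
  apply/forall_inP => y /setU1P[->|yK]; apply/implyP => neq.
- by rewrite eqxx in neq.
- exact: adj.
- by rewrite symE adj.
- exact: clique_adj clK xK yK neq.
Qed.

Definition stable_sets : {set {set V}} := [set S | stable E S].
Definition maximal_cliques : {set {set V}} := [set K | maxset (clique E) K].

Lemma maximal_clique_neq0 K : 0 < #|V| -> K \in maximal_cliques -> 0 < #|K|.
Proof.
rewrite inE => /card_gt0P[v _] /maxsetP[_ maxK]; rewrite card_gt0.
apply/eqP => K0; have := maxK _ (clique1 v); rewrite K0 sub0set => /(_ isT)/setP/(_ v).
by rewrite !inE eqxx.
Qed.

Lemma maximal_clique_nadj K v : K \in maximal_cliques -> v \notin K ->
  exists2 x, x \in K & ~~ E v x.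
Proof.
rewrite inE => /maxsetP[clK maxK] vK; apply/exists_inP; apply: contraNT vK.
rewrite negb_exists_in => /forall_inP adj.
rewrite -(maxK (v |: K)) ?setU11 ?subsetU1 //.
by apply: cliqueU1 => // x xK; apply/negPn/adj.
Qed.

Definition union_fibre W : {set {set V} * {set V}} :=
  [set p in finset.setX stable_sets maximal_cliques | p.1 :|: p.2 == W].

(** A common vertex [v] of [S] and [K] determines both: inside [S :|: K], the
    neighbours of [v] form [K :\ v] and its non-neighbours form [S]. *)
Lemma card_meeting_pairs W :
  #|[set p in union_fibre W | ~~ [disjoint p.1 & p.2]]| <= #|W|.
Proof.
pose f v := ([set x in W | ~~ E v x], v |: [set x in W | E v x]).
apply: leq_trans (leq_imset_card f W); apply/subset_leq_card/subsetP.
move=> [S K]; rewrite !inE /= -setI_eq0 => /andP[/andP[/andP[stS maxK] /eqP UW]].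
have [clK _] := maxsetP maxK.
case/set0Pn => v /setIP[vS vK]; apply/imsetP; exists v; first by rewrite -UW !inE vS.
congr (_, _); apply/setP => x; rewrite -UW !inE.
  case: (boolP (x \in S)) => [xS|xNS] /=; first by rewrite (stable_nadj stS).
  case: (boolP (x \in K)) => //= xK; apply/esym/negbTE/negPn.
  by apply: clique_adj clK _ _ _ => //; apply: contraNneq xNS => <-.
have [->|neq_xv] := eqVneq x v; first by rewrite vK.
case: (boolP (x \in K)) => [xK|xNK].
  by rewrite orbT (clique_adj clK) // eq_sym.
by rewrite orbF; case: (boolP (x \in S)) => //= xS; rewrite (stable_nadj stS).
Qed.

(** Two partitions of [W] into a stable set and a maximal clique differ by a
    single exchange [K = a |: K0 :\ b], where [b] is the only vertex of [K0] not
    adjacent to [a]; so [a] determines [K]. Since [K0] is not empty, [a] ranges over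
    fewer than [#|W|] vertices; with [K0] itself, at most [#|W|] pairs arise. *)
Lemma card_disjoint_pairs W : 0 < #|V| ->
  #|[set p in union_fibre W | [disjoint p.1 & p.2]]| <= #|W|.
Proof.
move=> V_gt0; set D := finset _.
have [D0|[[S0 K0] p0D]] := set_0Vmem D; first by rewrite D0 cards0.
have := p0D; rewrite !inE /= => /andP[/andP[/andP[stS0 maxK0] /eqP UW0] disj0].
have [clK0 _] := maxsetP maxK0.
pose g a := (W :\: (a |: [set x in K0 | E a x]), a |: [set x in K0 | E a x]).
have sub : D \subset (S0, K0) |: [set g a | a in S0].
  apply/subsetP => -[S K]; rewrite !inE /=.
  move=> /andP[/andP[/andP[stS maxK] /eqP UW] disj].
  have [clK _] := maxsetP maxK.
  have SE : S = W :\: K.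
    apply/setP => x; rewrite -UW !inE; case: (boolP (x \in S)) => xS /=.
      by rewrite (disjointFr disj).
    by case: (x \in K).
  have [eqK|neqK] := eqVneq K K0.
    apply/orP; left; rewrite SE eqK; apply/eqP; congr (_, _).
    apply/setP => x; rewrite -UW0 !inE; case: (boolP (x \in K0)) => xK /=.
      by rewrite (disjointFl disj0).
    by rewrite orbF.
  have /subsetPn[a aK aK0] : ~~ (K \subset K0).
    have [_ maxKE] := maxsetP maxK.
    by apply: contra neqK => sKK0; rewrite (maxKE K0).
  have inW x : x \in K -> x \in W by rewrite -UW inE => ->; rewrite orbT.
  have inW0 x : x \in K0 -> x \in W by rewrite -UW0 inE => ->; rewrite orbT.
  have outK x : x \in K0 -> x \notin K -> x \in S.
    by rewrite SE inE => /inW0-> ->.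
  have outK0 x : x \in K -> x \notin K0 -> x \in S0.
    by move=> /inW; rewrite -UW0 inE => /orP[//|->].
  have aS0 := outK0 a aK aK0.
  (* [K0] is maximal, so it cannot be enlarged by [a]. *)
  have [b bK0 nadj] : exists2 b, b \in K0 & ~~ E a b.
    by apply: maximal_clique_nadj aK0; rewrite inE.
  have bK : b \notin K.
    apply: contra nadj => bK; apply: clique_adj clK aK bK _.
    by apply: contraNneq aK0 => ->.
  have KE : K = a |: [set x in K0 | E a x].
    apply/setP => x; rewrite !inE; apply/idP/orP => [xK|].
      have [->|neq_xa] := eqVneq x a; [by left|right].
      rewrite (clique_adj clK aK xK) 1?eq_sym // andbT.
      apply: contraNT neq_xa => xK0; apply/eqP.
      by apply: (stable_clique_eq stS0 clK); rewrite inE ?aS0 ?outK0.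
    case=> [/eqP->//|/andP[xK0 axE]]; apply: contraLR axE => xK.
    suff -> : x = b by [].
    by apply: (stable_clique_eq stS clK0); rewrite inE outK.
  apply/orP; right; apply/imsetP; exists a => //.
  by rewrite /g -KE -SE.
apply: leq_trans (subset_leq_card sub) _.
apply: leq_trans (_ : 1 + #|S0| <= _).
  rewrite cardsU1 leq_add ?leq_imset_card //; exact: leq_b1.
have := maximal_clique_neq0 V_gt0 (_ : K0 \in _); rewrite inE => /(_ maxK0) K0_gt0.
rewrite -UW0 cardsU; move: disj0; rewrite -setI_eq0 => /eqP->.
by rewrite cards0 subn0 addnC leq_add2l.
Qed.

Lemma card_subsets : #|{set V}| = 2 ^ #|V|.
Proof. by rewrite -[LHS]cardsT -powersetT card_powerset cardsT. Qed.

Lemma sum_card_subsets : 2 * \sum_(W : {set V}) #|W| = #|V| * 2 ^ #|V|.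
Proof.
rewrite mulSn mul1n [X in X + _](reindex_inj (inv_inj (@setCK V))) /=.
rewrite -big_split /= (eq_bigr (fun=> #|V|)) => [|W _]; last first.
  by rewrite addnC cardsC.
by rewrite sum_nat_const card_subsets mulnC.
Qed.

Lemma card_stable_maximal_cliques : 0 < #|V| ->
  #|stable_sets| * #|maximal_cliques| <= #|V| * 2 ^ #|V|.
Proof.
move=> V_gt0; rewrite -cardsX -sum_card_subsets.
rewrite -sum1_card (partition_big (fun p => p.1 :|: p.2) xpredT) //= big_distrr /=.
apply: leq_sum => W _; rewrite mulSn mul1n.
rewrite (eq_bigl (mem (union_fibre W))) ?sum1_card => [|p]; last by rewrite !inE.
rewrite -(cardsID [set p : {set V} * {set V} | [disjoint p.1 & p.2]]).
apply: leq_add.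
  apply: leq_trans (card_disjoint_pairs W V_gt0); apply/eq_leq/eq_card => p.
  by rewrite !inE.
apply: leq_trans (card_meeting_pairs W); apply/eq_leq/eq_card => p.
by rewrite !inE andbC.
Qed.

Lemma card_stable_sets : #|stable_sets| <= 2 ^ #|V|.
Proof. by rewrite -card_subsets max_card. Qed.

Lemma stable_setsT : #|stable_sets| = 2 ^ #|V| -> stable E [set: V].
Proof.
rewrite -card_subsets => cardT; suff : finset.setT \in stable_sets by rewrite inE.
suff -> : stable_sets = finset.setT by rewrite inE.
by apply/eqP; rewrite eqEcard subsetT cardsT cardT /=.
Qed.

Lemma card_stable_sets_edgeless : stable E [set: V] -> #|stable_sets| = 2 ^ #|V|.
Proof.
move=> stT; rewrite -card_subsets -cardsT; congr #|pred_of_set _|.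
by apply/setP => S; rewrite !inE (stableS (subsetT S)).
Qed.

Lemma card_stable_facets : 0 < #|V| ->
  #|stable_sets| * (#|V| + #|maximal_cliques|) <= #|V| * 2 ^ #|V|.+1 /\
  (#|stable_sets| * (#|V| + #|maximal_cliques|) = #|V| * 2 ^ #|V|.+1 ->
   stable E [set: V]).
Proof.
move=> V_gt0; have bound := card_stable_maximal_cliques V_gt0.
have bound' : #|stable_sets| * #|V| <= #|V| * 2 ^ #|V|.
  by rewrite mulnC leq_mul2l card_stable_sets orbT.
have -> : #|V| * 2 ^ #|V|.+1 = #|V| * 2 ^ #|V| + #|V| * 2 ^ #|V|.
  by rewrite expnS mulnCA mulSn mul1n.
rewrite mulnDr; split=> [|eqM]; first exact: leq_add.
apply/stable_setsT/eqP; rewrite eqn_leq card_stable_sets.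
rewrite -(leq_pmul2l V_gt0) [X in _ <= X]mulnC.
by rewrite -(leq_add2r (#|V| * 2 ^ #|V|)) -eqM leq_add2l.
Qed.

End Counting.

(** * Weighted colourings of perfect graphs *)

Lemma ltn_sum_le (I : finType) (A : pred I) (F G : I -> nat) i :
  (forall j, F j <= G j) -> A i -> F i < G i ->
  \sum_(j | A j) F j < \sum_(j | A j) G j.
Proof.
move=> leFG Ai ltFG; rewrite (bigD1 i) //= [ltnRHS](bigD1 i) //= -addSn.
by apply: leq_add => //; apply: leq_sum.
Qed.

Section Colouring.
Variables (V : finType) (E : rel V).
Hypothesis irrE : irreflexive E.
Implicit Types (S K U : {set V}) (v : V) (s : seq {set V}).

Definition multiplicity s v : nat := count (fun S => v \in S) s.

Lemma sum_multiplicity s K :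
  \sum_(v in K) multiplicity s v = \sum_(S <- s) #|S :&: K|.
Proof.
under eq_bigr do rewrite /multiplicity -sum1_count big_mkcond.
rewrite exchange_big /=; apply: eq_bigr => S _.
rewrite -big_mkcondr /= sum1_card; apply: eq_card => v.
by rewrite inE andbC.
Qed.

Lemma sum_multiplicity_clique s K : all (stable E) s -> clique E K ->
  \sum_(v in K) multiplicity s v <= size s.
Proof.
move=> /allP st_s clK; rewrite sum_multiplicity -sum1_size big_seq.
rewrite [leqRHS]big_seq; apply: leq_sum => S /st_s stS.
exact: card_stable_clique stS clK.
Qed.

Lemma perfect_colouring (perfE : perfect irrE) U m :
    (forall K, K \subset U -> clique E K -> #|K| <= m) ->
  exists2 s, all (stable E) s && (size s <= m) &
    forall v, v \in U -> 0 < multiplicity s v.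
Proof.
move=> cl_le_m; set k := clique_number (induced E (S := U)).
have k_le_m : k <= m.
  apply/bigmax_leqP => K clK; rewrite -(card_imset _ val_inj).
  apply: cl_le_m.
    by apply/subsetP => _ /imsetP[x _ ->]; apply: valP.
  apply/forall_inP => _ /imsetP[x xK ->]; apply/forall_inP => _ /imsetP[y yK ->].
  apply/implyP; rewrite (inj_eq val_inj) => neq_xy.
  exact: (clique_adj clK xK yK neq_xy).
have : colorable (induced E (S := U)) k.
  by rewrite /k -perfE /chromatic_number; case: ex_minnP.
case/existsP => f /forallP colf.
pose cls (i : 'I_k) := [set val x | x in [set x | f x == i]].
exists [seq cls i | i <- enum 'I_k].
  rewrite size_map size_enum_ord k_le_m andbT; apply/allP => _ /mapP[i _ ->].
  apply/forall_inP => _ /imsetP[x xi ->]; apply/forall_inP => _ /imsetP[y yi ->].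
  move: xi yi; rewrite !inE => /eqP xi /eqP yi.
  have /forallP/(_ y)/implyP := colf x; rewrite xi yi eqxx /= => H.
  by apply/negP => /H.
move=> v vU; rewrite -has_count; apply/hasP.
exists (cls (f (exist _ v vU))); first by rewrite map_f ?mem_enum.
by apply/imsetP; exists (exist _ v vU); rewrite ?inE.
Qed.

(** Weighted form of perfection, equivalent to Lovász's replication lemma. If
    all weights are at most [1], it is the perfection of the subgraph where they
    are [1]. If [w v >= 2], a family for [w] with [v] lowered by one contains a
    stable set [S] through [v]. Every clique of weight [m] for the lowered weight
    avoids [v] and meets all the members of the family, so lowering the weight on
    [S :\ v] as well makes the bound [m - 1]; then [S] is added back. *)
Lemma weighted_colouring (perfE : perfect irrE) (w : V -> nat) m :
    (forall K, clique E K -> \sum_(v in K) w v <= m) ->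
  exists2 s, all (stable E) s && (size s <= m) &
    forall v, w v <= multiplicity s v.
Proof.
have [n] := ubnP (\sum_v w v); elim: n => // n IHn in w m *.
rewrite ltnS => w_le_n cl_le_m.
have [w_le1|/forallPn[v]] := boolP [forall v, w v <= 1].
  have [|s st_s cov] := perfect_colouring perfE (U := [set v | 0 < w v]) (m := m).
    move=> K sKU clK; apply: leq_trans (cl_le_m K clK).
    rewrite -sum1_card; apply: leq_sum => v vK.
    by have := subsetP sKU v vK; rewrite inE.
  exists s => // v; have := forallP w_le1 v.
  case: (posnP (w v)) => [->//|w_gt0 w_le]; apply: leq_trans w_le _.
  by apply: cov; rewrite inE.
rewrite -ltnNge => w_gt1.
pose w' u := w u - (u == v).
have w'_le u : w' u <= w u by rewrite leq_subr.
have sum_w' : \sum_u w' u < \sum_u w u.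
  apply: (@ltn_sum_le _ xpredT w' w v) => //.
  by rewrite /w' eqxx subn1 prednK // ltnW.
have cl_w' K : clique E K -> \sum_(u in K) w' u <= m.
  by move=> /cl_le_m; apply: leq_trans; apply: leq_sum.
have [s /andP[st_s sz_s] cov_s] := IHn w' m (leq_trans sum_w' w_le_n) cl_w'.
have /hasP[S Ss vS] : has (fun S => v \in S) s.
  rewrite has_count; apply: leq_trans (cov_s v).
  by rewrite /w' eqxx subn_gt0.
have stS := allP st_s S Ss.
have m_gt0 : 0 < m by apply: leq_trans sz_s; case: (s) Ss.
pose w'' u := w' u - (u \in S :\ v).
have w''_le u : w'' u <= w' u by rewrite leq_subr.
have [||s'' /andP[st_s'' sz_s''] cov_s''] := IHn w'' m.-1.
- by apply: leq_trans w_le_n; apply: leq_ltn_trans sum_w'; apply: leq_sum.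
- move=> K clK; rewrite -ltnS prednK //.
  have [w'K_lt|w'K_ge] := ltnP (\sum_(u in K) w' u) m.
    by apply: leq_ltn_trans w'K_lt; apply: leq_sum.
  have vNK : v \notin K.
    apply: contraL w'K_ge => vK; rewrite -ltnNge.
    apply: leq_trans (cl_le_m K clK); apply: (@ltn_sum_le _ [in K] w' w v) => //.
    by rewrite /w' eqxx subn1 prednK // ltnW.
  (* Now [K] has weight [m] for [w'], the largest weight that [s] can cover:
     every member of [s] meets [K], and [s] covers [K] with no excess. *)
  have cov_le : \sum_(u in K) multiplicity s u <= m.
    exact: leq_trans (sum_multiplicity_clique st_s clK) sz_s.
  have /card_gt0P[u /setIP[uS uK]] : 0 < #|S :&: K|.
    rewrite lt0n; apply: contraL w'K_ge => /eqP SK0; rewrite -ltnNge.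
    apply: leq_trans sz_s; apply: (@leq_ltn_trans (\sum_(u in K) multiplicity s u)).
      by apply: leq_sum.
    rewrite sum_multiplicity (big_rem S) //= SK0 add0n -sum_multiplicity.
    have -> : size s = (size (rem S s)).+1.
      by rewrite size_rem // prednK //; case: (s) Ss.
    rewrite ltnS sum_multiplicity_clique //; apply/allP => S' /mem_rem; exact/allP.
  have w'u : multiplicity s u <= w' u.
    rewrite leqNgt; apply: contraL w'K_ge => w'u; rewrite -ltnNge.
    by apply: leq_trans cov_le; apply: (@ltn_sum_le _ [in K] w' (multiplicity s) u).
  apply: leq_trans (cl_w' K clK); apply: (@ltn_sum_le _ [in K] w'' w' u) => //.
  rewrite /w'' !inE uS andbT.
  have -> : u != v by apply: contraNneq vNK => <-.
  rewrite subn1 prednK //; apply: leq_trans w'u.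
  by rewrite -has_count; apply/hasP; exists S.
exists (S :: s''); first by rewrite /= stS st_s'' -(prednK m_gt0).
move=> u; have := cov_s'' u; rewrite /multiplicity /= /w'' /w' !inE.
have [->|neq_uv] /= := eqVneq u v; first by rewrite vS subn0 leq_subLR.
by rewrite subn0 leq_subLR.
Qed.
End Colouring.

(** * A clique meeting the stable sets of maximum weight *)

Section MeetingClique.
Variables (R : realDomainType) (V : finType) (E : rel V).
Local Open Scope ring_scope.

(** If every clique [K] missed a stable set [T K] of maximum weight [b], weigh
    each vertex by the number of the sets [T K] through it. Each clique [K] misses
    [T K], so with [N] cliques all clique weights are below [N], and [N - 1] stable
    sets cover the multiset union of the [T K]; but this union has weight [N * b]. *)
Lemma clique_meeting_maximum_stable (irrE : irreflexive E)
    (perfE : perfect irrE) (c : V -> R) (b : R) :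
    (forall v, 0 <= c v) -> 0 < b ->
    (forall S, stable E S -> \sum_(v in S) c v <= b) ->
  exists2 K, K \in maximal_cliques E &
    forall S, stable E S -> \sum_(v in S) c v = b -> S :&: K != set0.
Proof.
move=> c_ge0 b_gt0 c_le_b.
pose tight K S := [&& stable E S, \sum_(v in S) c v == b & S :&: K == set0].
have [/exists_inP[K clK /forallP noS]|] :=
    boolP [exists (K | clique E K), forall S, ~~ tight K S].
  have [K' maxK' sKK'] := maxset_exists clK; exists K'; first by rewrite inE.
  move=> S stS cS; have := noS S; rewrite /tight stS cS eqxx /=.
  by apply: contra => /eqP SK'; rewrite -subset0 -SK' setIS.
rewrite negb_exists_in => /forall_inP allK.
pose T K := odflt set0 [pick S | tight K S].
have TP K : clique E K -> tight K (T K).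
  move=> /allK /forallPn[S /negPn tS]; rewrite /T.
  by case: pickP => [//|/(_ S)]; rewrite tS.
pose cliques := [set K | clique E K].
pose w v := (\sum_(K in cliques) (v \in T K))%N.
have sum_w (K' : {set V}) : (\sum_(v in K') w v = \sum_(K in cliques) #|T K :&: K'|)%N.
  rewrite exchange_big /=; apply: eq_bigr => K _.
  rewrite -big_mkcondr sum1_card; apply: eq_card => v; by rewrite inE andbC.
have N_gt0 : (0 < #|cliques|)%N.
  by apply/card_gt0P; exists set0; rewrite inE clique0.
have [K' clK'|s /andP[/allP st_s sz_s] cov] :=
    weighted_colouring perfE (w := w) (m := #|cliques|.-1).
  rewrite sum_w (bigD1 K') /= ?inE //.
  have /and3P[_ _ /eqP->] := TP K' clK'; rewrite cards0 add0n.
  rewrite (cardsD1 K') inE clK' add1n /= -sum1_card.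
  rewrite [leqRHS](eq_bigl (fun K => (K \in cliques) && (K != K'))) => [|K];
    last by rewrite !inE andbC.
  apply: leq_sum => K /andP[]; rewrite inE => /TP /and3P[stT _ _] _.
  exact: card_stable_clique stT clK'.
suff : #|cliques|%:R * b <= #|cliques|.-1%:R * b.
  by rewrite ler_pM2r // ler_nat leqNgt prednK // leqnn.
have sum_c (I : eqType) (r : seq I) (A : pred I) (F : I -> {set V}) :
    \sum_(i <- r | A i) \sum_(v in F i) c v
    = \sum_v c v *+ (\sum_(i <- r | A i) (v \in F i)).
  under eq_bigr do rewrite big_mkcond.
  rewrite exchange_big /=; apply: eq_bigr => v _; rewrite -sumrMnr.
  by apply: eq_bigr => i _; case: (v \in F i).
have -> : #|cliques|%:R * b = \sum_(K in cliques) \sum_(v in T K) c v.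
  rewrite mulr_natl -sumr_const; apply: eq_bigr => K; rewrite inE.
  by case/TP/and3P => _ /eqP.
apply: le_trans (_ : \sum_(S <- s) \sum_(v in S) c v <= _).
  rewrite !sum_c; apply: ler_sum => v _; apply: ler_wpMn2l => //.
  apply: leq_trans (cov v) _; rewrite /multiplicity -sum1_count big_mkcond /=.
  by apply: leq_sum => S _; case: (v \in S).
apply: le_trans (_ : \sum_(S <- s) b <= _).
  by rewrite big_seq [leRHS]big_seq; apply: ler_sum => S /st_s/c_le_b.
rewrite big_const_seq count_predT iter_addr_0 mulr_natl ler_wpMn2l ?ltW //.
Qed.
End MeetingClique.

Local Open Scope classical_set_scope.
Local Open Scope ring_scope.

(** * Cardinality of sets covered by a finite family *)

Section CountingImages.
Variables (I : finType) (T : choiceType) (D : {set I}) (f : I -> T) (X : set T).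

Lemma finite_sub_image : X `<=` f @` [set i | i \in D] -> finite_set X.
Proof. by move=> sX; apply: sub_finite_set sX _; apply: finite_image finite_finset. Qed.

Lemma card_fset_set_le : X `<=` f @` [set i | i \in D] -> (#|` fset_set X | <= #|D|)%N.
Proof.
move=> sX; rewrite cardE -(size_map f); apply: uniq_leq_size (fset_uniq _) _.
move=> x; rewrite in_fset_set; last exact: finite_sub_image.
by move=> /set_mem/sX[i iD <-]; apply: map_f; rewrite mem_enum.
Qed.

Lemma card_fset_set_ge : finite_set X -> {in D &, injective f} ->
  f @` [set i | i \in D] `<=` X -> (#|D| <= #|` fset_set X |)%N.
Proof.
move=> finX injf sX; rewrite cardE -(size_map f); apply: uniq_leq_size.
  rewrite map_inj_in_uniq ?enum_uniq // => i j; rewrite !mem_enum; exact: injf.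
move=> _ /mapP[i iD ->]; rewrite in_fset_set //; apply/mem_set/sX.
by exists i => //=; rewrite -mem_enum.
Qed.

End CountingImages.

(** * Hulls, dimension and faces *)

Section AffineGeometry.
Variables (R : realType) (W : vectType R).
Implicit Types (A P F : set W) (s : seq W) (U : {vspace W}) (c l : {scalar W}).

Lemma convex_hull_sum (I : finType) A (w : I -> R) (p : I -> W) :
  (forall i, 0 <= w i) -> \sum_i w i = 1 -> (forall i, A (p i)) ->
  convex_hull A (\sum_i w i *: p i).
Proof.
move=> w_ge0 sum_w Ap; exists #|I|, (w \o enum_val), (p \o enum_val).
split=> [i||i|] //=; first by rewrite -(big_enum_val w).
by rewrite [LHS]big_enum_val.
Qed.

Lemma affine_hull_sum (I : finType) A (w : I -> R) (p : I -> W) :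
  \sum_i w i = 1 -> (forall i, A (p i)) -> affine_hull A (\sum_i w i *: p i).
Proof.
move=> sum_w Ap; exists #|I|, (w \o enum_val), (p \o enum_val).
split=> [|i|] //=; first by rewrite -(big_enum_val w).
by rewrite [LHS]big_enum_val.
Qed.

Lemma sub_convex_hull A : A `<=` convex_hull A.
Proof.
move=> x Ax; exists 1%N, (fun=> 1), (fun=> x).
by split=> //; rewrite big_ord1 ?scale1r.
Qed.

Lemma convex_hull_midpoint A x y : convex_hull A x -> convex_hull A y ->
  convex_hull A (2^-1 *: (x + y)).
Proof.
move=> [n1 [w1 [p1 [w1_ge0 sum1 Ap1 ->]]]] [n2 [w2 [p2 [w2_ge0 sum2 Ap2 ->]]]].
pose w (i : 'I_n1 + 'I_n2) :=
  2^-1 * match i with inl i => w1 i | inr i => w2 i end.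
pose p (i : 'I_n1 + 'I_n2) := match i with inl i => p1 i | inr i => p2 i end.
have -> : 2^-1 *: (\sum_i w1 i *: p1 i + \sum_i w2 i *: p2 i)
    = \sum_i w i *: p i.
  rewrite big_sumType /= scalerDr !scaler_sumr.
  by congr (_ + _); apply: eq_bigr => i _; rewrite scalerA.
apply: convex_hull_sum => [[i|i]||[i|i]] //=.
- by rewrite mulr_ge0 ?invr_ge0 ?ler0n.
- by rewrite mulr_ge0 ?invr_ge0 ?ler0n.
- by rewrite big_sumType /= -!mulr_sumr sum1 sum2 -mulrDr mulVf ?pnatr_eq0.
Qed.

Lemma convex_hull_le A c b : (forall p, A p -> c p <= b) ->
  forall x, convex_hull A x -> c x <= b.
Proof.
move=> c_le_b x [n [w [p [w_ge0 sum_w Ap ->]]]].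
rewrite linear_sum -[b]mul1r -sum_w mulr_suml; apply: ler_sum => i _.
by rewrite linearZ ler_wpM2l ?c_le_b.
Qed.

(** A maximizer of [c] over a convex hull is a combination of generators that
    are themselves maximizers. *)
Lemma convex_hull_face_eq A c b l a : (forall p, A p -> c p <= b) ->
  (forall p, A p -> c p = b -> l p = a) ->
  forall x, convex_hull A x -> c x = b -> l x = a.
Proof.
move=> c_le_b l_eq x [n [w [p [w_ge0 sum_w Ap xE]]]] cx.
have slack0 : \sum_i w i * (b - c (p i)) = 0.
  under eq_bigr do rewrite mulrBr.
  rewrite sumrB -mulr_suml sum_w mul1r -cx xE linear_sum.
  by under eq_bigr do rewrite linearZ; rewrite subrr.
have slack_ge0 i : true -> 0 <= w i * (b - c (p i)).
  by rewrite mulr_ge0 // subr_ge0 c_le_b.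
rewrite xE linear_sum -[a]mul1r -sum_w mulr_suml; apply: eq_bigr => i _.
rewrite linearZ /=; have /eqP := psumr_eq0P slack_ge0 slack0 (i := i) isT.
rewrite mulf_eq0 subr_eq0 => /orP[/eqP->|/eqP bE]; first by rewrite !mul0r.
by rewrite (l_eq _ (Ap i)).
Qed.

Lemma convex_hull_face_generator A c b : (forall p, A p -> c p <= b) ->
  forall x, convex_hull A x -> c x = b -> exists2 p, A p & c p = b.
Proof.
move=> c_le_b x Ax cx; apply: contrapT => noA.
(* If no generator attains [b], then vacuously [c] takes any prescribed value,
   such as [b + 1], at all those that do. *)
suff : c x = b + 1 by rewrite cx => /eqP; rewrite -subr_eq0 opprD addNKr oppr_eq0 oner_eq0.
by apply: (convex_hull_face_eq c_le_b _ Ax cx) => p Ap cp; case: noA; exists p.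
Qed.

Lemma span_eq0 l s : (forall u, u \in s -> l u = 0) ->
  forall u, u \in <<s>>%VS -> l u = 0.
Proof.
move=> l0 u /(coord_span (X := in_tuple s))->; rewrite linear_sum big1 // => i _.
by rewrite linearZ /= l0 ?mulr0 //; apply: mem_nth.
Qed.

Lemma affine_hull_span A x0 s : A x0 -> (forall u, u \in s -> A (x0 + u)) ->
  (forall x, A x -> x - x0 \in <<s>>%VS) ->
  affine_hull A = [set x0 + u | u in [set u | u \in <<s>>%VS]].
Proof.
move=> Ax0 As span; apply/seteqP; split=> [_ [n [w [p [sum_w Ap ->]]]]|_ [u us <-]].
  exists (\sum_i w i *: (p i - x0)); last first.
    under eq_bigr do rewrite scalerBr.
    by rewrite sumrB -scaler_suml sum_w scale1r addrC subrK.
  by apply: memv_suml => i _; apply: memvZ; apply: span.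
rewrite /= in us; rewrite (coord_span (X := in_tuple s) us).
set k := coord _; pose w (i : unit + 'I_(size s)) :=
  if i is inr i then k i u else 1 - \sum_i k i u.
pose p (i : unit + 'I_(size s)) := if i is inr i then x0 + s`_i else x0.
have -> : x0 + \sum_i k i u *: s`_i = \sum_i w i *: p i.
  rewrite big_sumType /w /p /= big_const card_unit /= addr0.
  under [X in _ = _ + X]eq_bigr do rewrite scalerDr.
  by rewrite big_split /= -scaler_suml addrA -scalerDl subrK scale1r.
apply: affine_hull_sum => [|[[]|i]] //=.
  by rewrite big_sumType /w /p /= big_const card_unit /= addr0 subrK.
by apply: As; apply: mem_nth.
Qed.

Lemma flat_direction_sub x0 x1 U U' :
  [set x0 + u | u in [set u | u \in U]] `<=` [set x1 + u | u in [set u | u \in U']] ->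
  (U <= U')%VS.
Proof.
move=> sub; apply/subvP => u uU.
have [|u1 /= u1U' e1] := sub (x0 + 0); first by exists 0 => //=; apply: mem0v.
have [|u2 /= u2U' e2] := sub (x0 + u); first by exists u.
have -> : u = u2 - u1.
  by rewrite addr0 in e1; apply: (addrI x0); rewrite -e2 -e1 -addrA addrC subrKC addrC.
exact: memvB.
Qed.

Lemma affine_dim_flat A x0 U :
  affine_hull A = [set x0 + u | u in [set u | u \in U]] -> affine_dim A = \dim U.
Proof.
move=> hullA; rewrite /affine_dim.
set D := (X in xget _ X); have [x1 [U1 [hullA1 <-]]] : D (xget 0%N D).
  by apply: xgetPex; exists (\dim U), x0, U.
congr (\dim _); apply/eqP; rewrite eqEsubv.
apply/andP; split.
  by apply: (@flat_direction_sub x1 x0); rewrite -hullA -hullA1.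
by apply: (@flat_direction_sub x0 x1); rewrite -hullA -hullA1.
Qed.

Lemma affine_dim_span A x0 s : A x0 -> (forall u, u \in s -> A (x0 + u)) ->
  (forall x, A x -> x - x0 \in <<s>>%VS) -> affine_dim A = \dim <<s>>.
Proof. by move=> Ax0 As span; apply: affine_dim_flat (affine_hull_span Ax0 As span). Qed.

(** A family of differences [x - x0] spanning a subspace of maximal dimension
    spans them all. *)
Lemma exists_spanning_differences A x0 : A x0 -> exists s,
  (forall u, u \in s -> A (x0 + u)) /\ (forall x, A x -> x - x0 \in <<s>>%VS).
Proof.
move=> Ax0.
pose Q n := `[< exists s, (forall u, u \in s -> A (x0 + u)) /\ \dim <<s>> = n >].
have exQ : exists n, Q n.
  by exists (\dim <<[::] : seq W>>); apply/asboolP; exists [::].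
have Q_le n : Q n -> (n <= \dim {:W})%N.
  by move=> /asboolP[s [_ <-]]; apply/dimvS/subvf.
case: (ex_maxnP exQ Q_le) => n /asboolP[s [As dim_s]] n_max.
exists s; split=> // x Ax.
have sub : (<<s>> <= <<(x - x0) :: s>>)%VS by rewrite span_cons addvSr.
have -> : <<s>>%VS = <<(x - x0) :: s>>%VS.
  apply/eqP; rewrite eqEdim sub dim_s /=; apply: n_max; apply/asboolP.
  exists ((x - x0) :: s); split=> // u; rewrite inE => /orP[/eqP->|/As//].
  by rewrite addrC subrK.
by apply: memv_span; rewrite mem_head.
Qed.

Lemma dim_span_hyperplane l s v : (forall u, u \in s -> l u = 0) -> l v != 0 ->
  (forall x, x \in <<v :: s>>%VS) -> (\dim <<s>>).+1 = \dim {:W}.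
Proof.
move=> l0 lv full.
have vs_full : <<v :: s>>%VS = fullv.
  by apply/eqP; rewrite eqEsubv subvf; apply/subvP => x _; apply: full.
have v_notin : v \notin <<s>>%VS by apply: contra lv => /(span_eq0 l0)->.
apply/eqP; rewrite eqn_leq; apply/andP; split.
  rewrite -vs_full ltn_neqAle.
  have sub : (<<s>> <= <<v :: s>>)%VS by rewrite span_cons addvSr.
  rewrite dimvS // andbT.
  case: (dimv_leqif_sup sub) => _ ->.
  by apply: contra v_notin => /subvP; apply; rewrite memv_span ?mem_head.
rewrite -vs_full span_cons; apply: leq_trans (dimv_add_leqif _ _) _.
by rewrite -add1n leq_add2r dim_vline leq_b1.
Qed.

(** The differences of points of a facet span a space of codimension one on which
    [l] vanishes. Any further difference on which [l] vanishes belongs to it, for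
    otherwise the two would span the whole space and [l] would be zero. *)
Lemma facet_eq_hyperplane_section l P F a v : facets P F -> affine_dim P = \dim {:W} ->
  (forall x, F x -> l x = a) -> l v != 0 -> F = P `&` [set x | l x = a].
Proof.
move=> [[c [b [c_le_b FE]]] [x0 Fx0] dimF] dimP Fl lv.
have [s [Fs Fspan]] := exists_spanning_differences Fx0.
rewrite (affine_dim_span Fx0 Fs Fspan) dimP in dimF.
have cF x : F x -> c x = b by rewrite FE => -[].
have s_eq0 (g : {scalar W}) k : (forall x, F x -> g x = k) ->
    forall u, u \in <<s>>%VS -> g u = 0.
  move=> gF; apply: span_eq0 => u us; apply: (addrI (g x0)).
  by rewrite -linearD addr0 !gF //; apply: Fs.
apply/seteqP; split=> [x Fx|x [Px lx]].
  by split; [rewrite FE in Fx; case: Fx|exact: Fl].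
rewrite FE; split=> //=.
suff /(s_eq0 _ _ cF)/eqP : x - x0 \in <<s>>%VS.
  by rewrite linearB subr_eq0 (cF _ Fx0) => /eqP.
apply: contraNT lv => xNs.
have l_eq0 u : u \in (x - x0) :: s -> l u = 0.
  rewrite inE => /orP[/eqP->|us]; first by rewrite linearB lx (Fl _ Fx0) subrr.
  by apply: (s_eq0 _ _ Fl); apply: memv_span.
suff full : <<(x - x0) :: s>>%VS = fullv.
  by rewrite (span_eq0 l_eq0) // full memvf.
have sub : (<<s>> <= <<(x - x0) :: s>>)%VS by rewrite span_cons addvSr.
apply/eqP; rewrite eqEdim subvf -dimF ltn_neqAle dimvS // andbT.
case: (dimv_leqif_sup sub) => _ ->.
by apply: contra xNs => /subvP; apply; rewrite memv_span ?mem_head.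
Qed.

End AffineGeometry.

(** * Linear forms on coordinate spaces *)

Section DotProduct.
Variables (R : realType) (V : finType).
Implicit Types (S K : {set V}) (v : V) (x y : coords R V).

Definition dot (a x : coords R V) : R := \sum_v a v * x v.

Lemma dot_is_linear a : GRing.linear_for *%R (dot a).
Proof.
move=> k x y; rewrite /dot mulr_sumr -big_split; apply: eq_bigr => v _.
by rewrite !ffunE mulrDr mulrCA.
Qed.

HB.instance Definition _ a :=
  GRing.isLinear.Build R (coords R V) R *%R (dot a) (dot_is_linear a).

Local Notation chi := (@char_vector R V).
Local Notation e v := (chi [set v]).

Lemma dotNl a x : dot (- a) x = - dot a x.
Proof. by rewrite /dot -sumrN; apply: eq_bigr => v _; rewrite ffunE mulNr. Qed.

Lemma dot_char K x : dot (chi K) x = \sum_(v in K) x v.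
Proof.
rewrite big_mkcond; apply: eq_bigr => v _; rewrite ffunE.
by case: (v \in K); rewrite ?mul1r ?mul0r.
Qed.

Lemma dot_unit v x : dot (e v) x = x v.
Proof. by rewrite dot_char big_set1. Qed.

Lemma dot_char_char K S : dot (chi K) (chi S) = #|S :&: K|%:R.
Proof.
rewrite dot_char -sum1_card natr_sum big_mkcond [RHS]big_mkcond.
by apply: eq_bigr => v _; rewrite ffunE inE andbC; do 2!case: (_ \in _).
Qed.

Lemma dot_unitr a v : dot a (e v) = a v.
Proof.
rewrite /dot (bigD1 v) //= ffunE inE eqxx mulr1 big1 ?addr0 // => u.
by rewrite ffunE inE => /negbTE->; rewrite mulr0.
Qed.

Lemma coords_sum x : x = \sum_v x v *: e v.
Proof.
apply/ffunP => u; rewrite sum_ffunE (bigD1 u) //= !ffunE inE eqxx.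
rewrite big1 => [|v neq_vu]; first by rewrite addr0 [RHS]mulr1.
by rewrite !ffunE inE eq_sym (negbTE neq_vu) [LHS]mulr0.
Qed.

Lemma scalarE (c : {scalar coords R V}) x : c x = \sum_v x v * c (e v).
Proof. by rewrite {1}(coords_sum x) linear_sum; apply: eq_bigr => v _; rewrite linearZ. Qed.

Lemma scalar_char (c : {scalar coords R V}) S : c (chi S) = \sum_(v in S) c (e v).
Proof.
rewrite scalarE [RHS]big_mkcond; apply: eq_bigr => v _; rewrite ffunE.
by case: (v \in S); rewrite ?mul1r ?mul0r.
Qed.

Lemma char_vector_inj : injective chi.
Proof.
move=> S K /ffunP eqSK; apply/setP => v; have := eqSK v; rewrite !ffunE => /eqP.
by rewrite eqr_nat; do 2!case: (_ \in _).
Qed.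

Lemma unit_span (A : {set V}) x : (forall v, v \notin A -> x v = 0) ->
  x \in <<[seq e v | v <- enum A]>>%VS.
Proof.
move=> x0; rewrite (coords_sum x); apply: memv_suml => v _.
have [vA|/x0->] := boolP (v \in A); last by rewrite scale0r mem0v.
by apply/memvZ/memv_span/map_f; rewrite mem_enum.
Qed.

Lemma dim_coords : \dim {: coords R V} = #|V|.
Proof. by rewrite dimvf; apply: muln1. Qed.

End DotProduct.

(** * Vertices and facets of the stable set polytope *)

Section StableSetPolytope.
Variables (R : realType) (V : finType) (E : rel V).
Hypothesis irrE : irreflexive E.
Implicit Types (S K : {set V}) (v : V) (x : coords R V) (F : set (coords R V)).
Local Notation P := (STAB R E).
Local Notation chi := (@char_vector R V).
Local Notation e v := (chi [set v]).

Lemma STAB_char S : stable E S -> P (chi S).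
Proof. by move=> stS; apply: sub_convex_hull; exists S. Qed.

Lemma char_vector0 : chi set0 = 0.
Proof. by apply/ffunP => v; rewrite !ffunE inE. Qed.

Lemma affine_dim_STAB : affine_dim P = #|V|.
Proof.
rewrite (@affine_dim_span _ _ _ 0 [seq e v | v <- enum [set: V]%SET]).
- rewrite -(dim_coords R V); congr (\dim _); apply/eqP; rewrite eqEsubv subvf /=.
  by apply/subvP => x _; apply: unit_span => v; rewrite inE.
- by rewrite -char_vector0; apply/STAB_char/stable0.
- by move=> _ /mapP[v _ ->]; rewrite add0r; apply/STAB_char/stable1.
- by move=> x _; apply: unit_span => v; rewrite inE.
Qed.

Lemma STAB_le (c : {scalar coords R V}) b :
  (forall S, stable E S -> c (chi S) <= b) -> forall x, P x -> c x <= b.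
Proof. by move=> c_le; apply: convex_hull_le => _ [S stS ->]; apply: c_le. Qed.

Lemma STAB_face_eq (c l : {scalar coords R V}) b a :
  (forall x, P x -> c x <= b) ->
  (forall S, stable E S -> c (chi S) = b -> l (chi S) = a) ->
  forall x, P x -> c x = b -> l x = a.
Proof.
move=> c_le l_eq; apply: convex_hull_face_eq => [p Ap|_ [S stS ->]].
  exact/c_le/sub_convex_hull.
exact: l_eq.
Qed.

Lemma STAB_face_generator (c : {scalar coords R V}) b x :
  (forall x, P x -> c x <= b) -> P x -> c x = b ->
  exists2 S, stable E S & c (chi S) = b.
Proof.
move=> c_le Px cx.
have [|_ [S stS ->] cS] := convex_hull_face_generator _ Px cx; last by exists S.
by move=> p Ap; apply/c_le/sub_convex_hull.
Qed.

Lemma STAB_ge0 x v : P x -> 0 <= x v.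
Proof.
move=> Px; rewrite -oppr_le0 -dot_unit -dotNl.
apply: STAB_le Px => S _ /=; rewrite dotNl dot_char_char oppr_le0; exact: ler0n.
Qed.

Lemma STAB_clique_le1 x K : clique E K -> P x -> dot (chi K) x <= 1.
Proof.
move=> clK; apply: STAB_le => S stS /=; rewrite dot_char_char lern1.
exact: card_stable_clique stS clK.
Qed.

Lemma affine_dim_point x : affine_dim [set x] = 0%N.
Proof.
rewrite (@affine_dim_span _ _ _ x [::]) ?span_nil ?dimv0 //.
by move=> _ ->; rewrite subrr mem0v.
Qed.

(** Coefficients of a form whose maximum over the stable set polytope is attained
    at the characteristic vector of [S] only. *)
Definition peak S : coords R V := chi S - chi (~: S).

Lemma peakE S K : dot (peak S) (chi K) = #|K :&: S|%:R - #|K :\: S|%:R.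
Proof.
rewrite setDE -!dot_char_char /dot -sumrB; apply: eq_bigr => v _.
by rewrite [peak S v]ffunE [(- _ : coords R V) v]ffunE mulrBl.
Qed.

Lemma peak_le S x : P x -> dot (peak S) x <= #|S|%:R.
Proof.
apply: STAB_le => K _ /=; rewrite peakE lerBlDr -natrD ler_nat.
by apply: leq_trans (leq_addr _ _); apply/subset_leq_card/subsetIr.
Qed.

Lemma peak_eq S K : dot (peak S) (chi K) = #|S|%:R -> K = S.
Proof.
rewrite peakE => /eqP; rewrite subr_eq -natrD eqr_nat => /eqP cardE.
have le_S : (#|K :&: S| <= #|S|)%N by apply/subset_leq_card/subsetIr.
have KDS : K :\: S = set0.
  by apply/eqP; rewrite -cards_eq0 -leqn0 -(leq_add2l #|S|) addn0 -cardE.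
apply/eqP; rewrite eqEcard -setD_eq0 KDS eqxx /=.
by rewrite -(cardsID S K) KDS cards0 addn0 cardE leq_addr.
Qed.

Lemma vertices_STAB : vertices P = [set [set chi S] | S in [set S | S \in stable_sets E]].
Proof.
apply/seteqP; split=> [F [[c [b [c_le FE]]] [x0 Fx0] dimF]|_ [S stS <-]].
  have [s [Fs Fspan]] := exists_spanning_differences Fx0.
  have F1 x : F x -> x = x0.
    move=> /Fspan; move: dimF; rewrite (affine_dim_span Fx0 Fs Fspan) => /eqP.
    by rewrite dimv_eq0 => /eqP->; rewrite memv0 subr_eq0 => /eqP.
  have [Px0 cx0] : (P `&` [set x | c x = b]) x0 by rewrite -FE.
  have [S stS cS] := STAB_face_generator c_le Px0 cx0.
  have -> : F = [set chi S].
    have FS : F (chi S) by rewrite FE; split=> //; apply: STAB_char.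
    by apply/seteqP; split=> [x /F1->|_ ->//]; rewrite (F1 _ FS).
  by exists S => //=; rewrite inE.
rewrite /= inE in stS; split.
- exists (dot (peak S) : {scalar _}), #|S|%:R; split; first exact: peak_le.
  apply/seteqP; split=> [_ ->|x [Px /= cx]].
    split; first exact: STAB_char.
    by rewrite /= peakE finset.setIid finset.setDv cards0 subr0.
  apply/ffunP => v; rewrite -[LHS]dot_unit.
  apply: (STAB_face_eq (@peak_le S) _ Px cx) => K _ /peak_eq->.
  exact: dot_unit.
- by exists (chi S).
- exact: affine_dim_point.
Qed.

Lemma num_vertices_STAB : num_vertices P = #|stable_sets E|.
Proof.
pose f S : set (coords R V) := [set chi S].
have inj : {in stable_sets E &, injective f}.
  by move=> S K _ _ /seteqP[/(_ _ erefl) /char_vector_inj].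
have sub : vertices P `<=` f @` [set S | S \in stable_sets E] by rewrite vertices_STAB.
apply/eqP; rewrite eqn_leq (card_fset_set_le sub) /=.
by apply: (card_fset_set_ge (finite_sub_image sub) inj); rewrite vertices_STAB.
Qed.

Definition facet_index : {set V + {set V}} :=
  ([set inl v | v in [set: V]] :|: [set inr K | K in maximal_cliques E])%SET.

Definition facet_of (i : V + {set V}) : set (coords R V) :=
  match i with
  | inl v => P `&` [set x | dot (e v) x = 0]
  | inr K => P `&` [set x | dot (chi K) x = 1]
  end.

Lemma card_facet_index : (#|facet_index| <= #|V| + #|maximal_cliques E|)%N.
Proof.
apply: leq_trans (leq_card_setU _ _).1 _.
by apply: leq_add; apply: leq_trans (leq_imset_card _ _) _; rewrite ?cardsT.
Qed.

(** A facet not contained in any [x v = 0] has, through each vertex [v], a stable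
    set on which its defining form [c] is maximum. Deleting [v] from that set shows
    [0 <= c (e v)], so some clique [K] meets every maximizing stable set, and the
    facet is contained in the hyperplane where the sum over [K] is [1]. *)
Lemma facets_STAB (perfE : perfect irrE) :
  facets P `<=` facet_of @` [set i | i \in facet_index].
Proof.
move=> F FP; have [[c [b [c_le FE]]] [x0 Fx0] dimF] := FP.
have dimP : affine_dim P = \dim {: coords R V} by rewrite affine_dim_STAB dim_coords.
have lF (l : {scalar coords R V}) a :
    (forall S, stable E S -> c (chi S) = b -> l (chi S) = a) ->
    forall x, F x -> l x = a.
  by move=> l_eq x; rewrite FE => -[Px cx]; apply: STAB_face_eq c_le l_eq _ Px cx.
have unit_neq0 v : dot (e v) (e v) != 0 :> R.
  by rewrite dot_char_char finset.setIid cards1 oner_eq0.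
have c_leS S : stable E S -> c (chi S) <= b by move=> /STAB_char/c_le.
have [[v noS]|allv] := pselect
    (exists v, forall S, stable E S -> c (chi S) = b -> v \notin S).
  exists (inl v); first by rewrite /= inE imset_f ?inE.
  apply/esym/(facet_eq_hyperplane_section (l := dot (e v)) FP dimP _ (unit_neq0 v)).
  apply: lF => S stS cS /=; rewrite dot_unit ffunE.
  by rewrite (negbTE (noS S stS cS)).
have tight v : exists S, [/\ stable E S, c (chi S) = b & v \in S].
  apply: contrapT => noS; apply: allv; exists v => S stS cS.
  by apply/negP => vS; apply: noS; exists S.
have c_ge0 v : 0 <= c (e v).
  have [S [stS cS vS]] := tight v.
  have := c_leS _ (stableS (subsetDl S [set v]) stS).
  rewrite -cS (scalar_char c S) (scalar_char c (S :\ v)%SET) (big_setD1 v vS) /=.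
  by rewrite lerDr.
have b_ge0 : 0 <= b by have := c_leS _ (stable0 E); rewrite char_vector0 linear0.
(* If [b = 0] then [c] vanishes and the facet is the whole polytope. *)
have b_gt0 : 0 < b.
  rewrite lt_def b_ge0 andbT; apply/eqP => b0.
  have c0 v : c (e v) = 0.
    by apply/eqP; rewrite eq_le c_ge0 andbT -b0 c_leS ?stable1.
  have FP' : F = P.
    rewrite FE; apply/seteqP; split=> [x []//|x Px]; split=> //=.
    by rewrite scalarE b0 big1 // => v _; rewrite c0 mulr0.
  by move: dimF; rewrite FP' => /eqP; rewrite gtn_eqF.
have [S stS|K maxK meetK] := clique_meeting_maximum_stable perfE c_ge0 b_gt0.
  by rewrite -scalar_char; apply: c_leS.
have clK : clique E K by move: maxK; rewrite inE => /maxsetP[].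
have [Px0 cx0] : (P `&` [set x | c x = b]) x0 by rewrite -FE.
have [S0 stS0 cS0] := STAB_face_generator c_le Px0 cx0.
have [v /setIP[_ vK]] : exists v, v \in S0 :&: K.
  by apply/set0Pn/meetK => //; rewrite -scalar_char.
exists (inr K); first by rewrite /= inE imset_f ?orbT.
apply/esym/(facet_eq_hyperplane_section (l := dot (chi K)) (v := e v) FP dimP).
  apply: lF => S stS cS /=; rewrite dot_char_char.
  apply/eqP; rewrite pnatr_eq1 eqn_leq (card_stable_clique stS clK) //= card_gt0.
  by apply: meetK => //; rewrite -scalar_char.
by rewrite /= dot_unitr ffunE vK oner_eq0.
Qed.

Lemma num_facets_STAB_le (perfE : perfect irrE) :
  (num_facets P <= #|V| + #|maximal_cliques E|)%N.
Proof.
apply: leq_trans card_facet_index; apply: card_fset_set_le.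
exact: facets_STAB.
Qed.

Lemma num_facets_STAB0 : #|V| = 0%N -> num_facets P = 0%N.
Proof.
move=> V0; rewrite /num_facets (_ : facets P = classical_sets.set0) ?fset_set0 ?cardfs0 //.
by apply/seteqP; split=> // F [_ _]; rewrite affine_dim_STAB V0.
Qed.

End StableSetPolytope.

(** * Graphs without edges *)

Section Edgeless.
Variables (R : realType) (V : finType) (E : rel V).
Hypothesis irrE : irreflexive E.
Hypothesis edgeless : stable E [set: V].
Implicit Types (S K : {set V}) (v : V) (x : coords R V).
Local Notation P := (STAB R E).
Local Notation chi := (@char_vector R V).
Local Notation e v := (chi [set v]).

Lemma edgeless_stable S : stable E S.
Proof. exact: stableS (finset.subsetT S) edgeless. Qed.

Lemma prodrD_subsets (F G : V -> R) :
  \prod_v (F v + G v) = \sum_(S : {set V}) \prod_v (if v \in S then F v else G v).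
Proof. by rewrite finset.bigA_distr; apply: eq_bigl. Qed.

(** A point [x] of the unit cube is the mean of a random vertex whose coordinates
    are independent, the coordinate at [v] being [1] with probability [x v]. *)
Lemma STAB_edgeless x : (forall v, 0 <= x v <= 1) -> P x.
Proof.
move=> x01; pose w (S : {set V}) := \prod_v (if v \in S then x v else 1 - x v).
have -> : x = \sum_(S : {set V}) w S *: chi S.
  apply/ffunP => u; rewrite sum_ffunE.
  (* Setting the factor of [u] to [0] outside [S] keeps the sets containing [u]. *)
  transitivity (\sum_(S : {set V}) \prod_v
      (if v \in S then x v else if v == u then 0 else 1 - x v)).
    rewrite -prodrD_subsets.
    rewrite (bigD1 u) //= eqxx addr0 big1 ?mulr1 // => v /negbTE->.
    by rewrite addrC subrK.
  apply: eq_bigr => S _; rewrite !ffunE; have [uS|uS] := boolP (u \in S).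
    rewrite [RHS]mulr1; apply: eq_bigr => v _.
    by have [->|] := eqVneq v u; rewrite ?uS.
  by rewrite [RHS]mulr0 (bigD1 u) //= (negbTE uS) eqxx mul0r.
apply: convex_hull_sum => [S||S].
- apply: prodr_ge0 => v _; have /andP[x_ge0 x_le1] := x01 v.
  by case: ifP; rewrite ?subr_ge0.
- rewrite -prodrD_subsets big1 // => v _.
  by rewrite addrC subrK.
- by exists S => //; apply: edgeless_stable.
Qed.

Definition to_cube x : coords R 'I_#|V| := [ffun i => 2 * x (enum_val i)].

Lemma to_cube_is_linear : linear to_cube.
Proof.
move=> k x y; apply/ffunP => i; rewrite !ffunE mulrDr.
by rewrite [2 * (k *: x _)]mulrCA.
Qed.

HB.instance Definition _ :=
  GRing.isLinear.Build R (coords R V) (coords R 'I_#|V|) _ to_cube to_cube_is_linear.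

Lemma STAB_edgeless_cube : affinely_isomorphic P (cube R #|V|).
Proof.
exists (to_cube : {linear _ -> _}), [ffun=> - 1]; split.
- move=> x Px i; rewrite !ffunE.
  have := STAB_ge0 (enum_val i) Px.
  have := STAB_clique_le1 (clique1 E (enum_val i)) Px.
  rewrite dot_unit; lra.
- move=> x y _ _ /addIr /ffunP eqxy; apply/ffunP => v.
  have := eqxy (enum_rank v); rewrite !ffunE enum_rankK; lra.
move=> y Qy; exists [ffun v => (y (enum_rank v) + 1) / 2].
  apply: STAB_edgeless => v; rewrite ffunE; have := Qy (enum_rank v); lra.
by apply/ffunP => i; rewrite !ffunE enum_valK; lra.
Qed.

Definition cube_facet (p : V * bool) : set (coords R V) :=
  P `&` [set x | x p.1 = p.2%:R].

Lemma cube_facetP (p : V * bool) : facets P (cube_facet p).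
Proof.
case: p => v b; have faceF : face P (cube_facet (v, b)).
  case: b.
    exists (dot (e v) : {scalar _}), 1; split.
      by move=> x; apply/STAB_clique_le1/clique1.
    by congr (_ `&` _); apply/seteqP; split=> x /=; rewrite dot_unit.
  exists (dot (- e v) : {scalar _}), 0; split.
    by move=> x /(STAB_ge0 v); rewrite /= dotNl dot_unit oppr_le0.
  congr (_ `&` _); apply/seteqP; split=> x /=; rewrite dotNl dot_unit.
    by move=> ->; rewrite oppr0.
  by move=> /eqP; rewrite oppr_eq0 => /eqP.
pose S0 : {set V} := if b then [set v]%SET else set0.
pose s := [seq e u | u <- enum (~: [set v])%SET].
have S0v : chi S0 v = b%:R by rewrite ffunE /S0; case: (b); rewrite !inE ?eqxx.
have FS0 : cube_facet (v, b) (chi S0).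
  by split; [apply/STAB_char/edgeless_stable|].
split=> //; first by exists (chi S0).
rewrite (affine_dim_span (s := s) FS0) => [|_ /mapP[u + ->]|x [Px /= xv]].
- rewrite (dim_span_hyperplane (l := dot (e v)) (v := e v)) ?affine_dim_STAB ?dim_coords //.
  + move=> _ /mapP[u + ->]; rewrite mem_enum !inE => neq_uv.
    by rewrite /= dot_unit ffunE inE eq_sym (negbTE neq_uv).
  + by rewrite /= dot_unit ffunE inE eqxx oner_eq0.
  + move=> x; rewrite span_cons (coords_sum x) (bigD1 v) //=.
    apply: memv_add; first by rewrite memvZ ?memv_line.
    apply: memv_suml => u neq_uv; apply/memvZ/memv_span/map_f.
    by rewrite mem_enum !inE.
- rewrite mem_enum !inE => neq_uv.
  have -> : chi S0 + e u = chi (u |: S0).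
    have uS0 : u \notin S0 by rewrite /S0; case: (b); rewrite !inE.
    apply/ffunP => z; rewrite !ffunE !inE.
    by have [->|] := eqVneq z u; rewrite ?(negbTE uS0) ?add0r ?addr0.
  split; first by apply/STAB_char/edgeless_stable.
  by rewrite /= ffunE !inE eq_sym (negbTE neq_uv) -S0v ffunE.
- apply: unit_span => u; rewrite !inE negbK => /eqP->.
  by rewrite ffunE [X in _ + X]ffunE S0v xv subrr.
Qed.

Lemma num_facets_edgeless (perfE : perfect irrE) : (2 * #|V| <= num_facets P)%N.
Proof.
have -> : (2 * #|V| = #|[set: V * bool]%SET|)%N.
  by rewrite cardsT card_prod card_bool mulnC.
apply: (@card_fset_set_ge _ _ _ cube_facet).
- by apply: finite_sub_image; apply: facets_STAB perfE.
- move=> [v b] [v' b'] _ _ eqF; pose S := [set u | if u == v then b else ~~ b']%SET.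
  (* The vertex [chi S] is on the first facet, and on the second only if the two
     pairs are equal. *)
  have : cube_facet (v, b) (chi S).
    by split; [apply/STAB_char/edgeless_stable|rewrite /= ffunE inE eqxx].
  rewrite eqF => -[_ /eqP]; rewrite /= ffunE inE eqr_nat.
  by have [->|_] := eqVneq v' v; case: (b); case: (b').
- by move=> _ [p _ <-]; apply: cube_facetP.
Qed.

End Edgeless.

(** * Central symmetry and the case of equality *)

Lemma cube_opp (R : realType) d (x : coords R 'I_d) : cube R d x -> cube R d (- x).
Proof. by move=> Qx i; rewrite ffunE; have := Qx i; lra. Qed.

Lemma cross_polytope_opp (R : realType) d (x : coords R 'I_d) :
  cross_polytope R d x -> cross_polytope R d (- x).
Proof.
move=> Qx y /cube_opp /Qx; apply: le_trans; rewrite le_eqVlt.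
by apply/orP; left; apply/eqP/eq_bigr => i _; rewrite !ffunE mulrN mulNr.
Qed.

(** The central symmetry of [Q] pulls back to [x |-> y - x], where [y] is the image
    of [0]: as the affine map is only known to be injective on the polytope, this
    follows from the equality of the images of two midpoints. Then [y - e v] has
    nonnegative coordinates for every [v], and [y] violates the inequality of any
    edge. *)
Lemma affinely_isomorphic_sym_edgeless (R : realType) (V : finType) (E : rel V)
    (symE : symmetric E) (irrE : irreflexive E) (W : vectType R) (Q : set W) :
  (forall x, Q x -> Q (- x)) -> affinely_isomorphic (STAB R E) Q ->
  stable E [set: V].
Proof.
move=> oppQ [f [b [PQ injf surjf]]].
have P0 : STAB R E 0 by rewrite -(char_vector0 R V); apply/STAB_char/stable0.
have [y Py fy] : exists2 y, STAB R E y & f y + b = - (f 0 + b).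
  by apply: surjf; apply/oppQ/PQ.
have reflect x : STAB R E x -> STAB R E (y - x).
  move=> Px; have [x' Px' fx'] := surjf _ (oppQ _ (PQ _ Px)).
  suff -> : y - x = x' by [].
  have half_neq0 : 2^-1 != 0 :> R by rewrite invr_eq0 pnatr_eq0.
  have /injf : f (2^-1 *: (x + x')) + b = f (2^-1 *: (y + 0)) + b.
    congr (_ + b); rewrite !linearZ !linearD linear0; congr (_ *: _).
    have -> : f x' = - (f x + b) - b by rewrite -fx' addrK.
    have -> : f y = - (f 0 + b) - b by rewrite -fy addrK.
    by rewrite linear0 addr0 add0r opprD !addrA subrr add0r.
  move=> /(_ (mem_set (convex_hull_midpoint Px Px'))).
  move=> /(_ (mem_set (convex_hull_midpoint Py P0))).
  by move=> /(scalerI half_neq0) xx'; rewrite -[y]addr0 -xx' addrC addKr.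
have y_ge1 v : 1 <= y v.
  have /(STAB_ge0 v) := reflect _ (STAB_char R (stable1 irrE v)).
  by rewrite !ffunE inE eqxx subr_ge0.
apply/forall_inP => u _; apply/forall_inP => v _; apply/negP => uv.
have uNv : u \notin [set v]%SET by apply: contraTN uv => /set1P->; rewrite irrE.
have clK : clique E (u |: [set v]).
  by apply: (cliqueU1 symE (clique1 E v)) => x /set1P->.
have := STAB_clique_le1 clK Py; rewrite dot_char big_setU1 // big_set1.
rewrite leNgt => /negP; apply.
by apply: lt_le_trans (lerD (y_ge1 u) (y_ge1 v)); rewrite ltrDl ltr01.
Qed.

Theorem lemma7 (R : realType) (V : finType) (E : rel V)
    (symE : symmetric E) (irrE : irreflexive E) (perfE : perfect irrE) :
  let P := STAB R E in
  let d := affine_dim P in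
  (num_vertices P * num_facets P <= d * 2 ^ d.+1)%N /\
  ((num_vertices P * num_facets P = d * 2 ^ d.+1)%N <->
   affinely_isomorphic P (cube R d) \/
   affinely_isomorphic P (cross_polytope R d)).
Proof.
move=> P; rewrite /= (affine_dim_STAB R irrE).
have [boundP eqP_edgeless] :
    (num_vertices P * num_facets P <= #|V| * 2 ^ #|V|.+1)%N /\
    ((num_vertices P * num_facets P = #|V| * 2 ^ #|V|.+1)%N -> stable E [set: V]%SET).
  have [V0|V_gt0] := posnP #|V|.
    rewrite (num_facets_STAB0 R irrE V0) muln0; split=> // _.
    by apply/forall_inP => v; have := max_card (pred1 v); rewrite V0 card1.
  have [bound eq_edgeless] := card_stable_facets symE V_gt0.
  have facets_le := num_facets_STAB_le R perfE.
  rewrite num_vertices_STAB //.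
  have le : (#|stable_sets E| * num_facets P <=
             #|stable_sets E| * (#|V| + #|maximal_cliques E|))%N.
    by rewrite leq_mul2l facets_le orbT.
  split=> [|eqM]; first exact: leq_trans bound.
  by apply: eq_edgeless; apply/eqP; rewrite eqn_leq bound -eqM.
split=> //; split=> [/eqP_edgeless edgeless|isoP].
  by left; apply: STAB_edgeless_cube.
have edgeless : stable E [set: V]%SET.
  case: isoP; apply: affinely_isomorphic_sym_edgeless => //.
    exact: cube_opp.
  exact: cross_polytope_opp.
apply/eqP; rewrite eqn_leq boundP num_vertices_STAB // (card_stable_sets_edgeless edgeless).
by rewrite expnS mulnA mulnC leq_mul2l mulnC num_facets_edgeless ?orbT.
Qed.
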